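(* Let $X$ be a finite rack with connected components $C_1,\dots,C_k$. There exists $N$ (depending on $X$) such that the following holds. Let $s=(x_1,\dots,x_n)\in X^n$ with $\langle x_1,\dots,x_n\rangle=X$, let $D_j=\{1\le i\le n: x_i\in C_j\}$ and $n_j=|D_j|$, and suppose $n_1,\dots,n_k\ge N$. Then the image in $S_n$ of the stabilizer of $s$ in $B_n$ contains $A_{n_1}\times\dots\times A_{n_k}$.
   Context: A rack is a set $X$ with an operation $x^y$ such that $x\mapsto x^y$ is bijective for each $y$ and $(z^x)^y=(z^y)^{x^y}$; its connected components are the classes of the smallest equivalence relation with $x\sim x^y$; $\langle x_1,\dots,x_n\rangle=X$ means no proper subset of $X$ closed under the operation contains all $x_i$. $B_n$ acts on $X^n$ from the right by $(\dots,x_i,x_{i+1},\dots)^{\sigma_i}=(\dots,x_{i+1},x_i^{x_{i+1}},\dots)$, and $B_n\to S_n$ sends $\sigma_i\mapsto(i\ i+1)$. $S_{n_1}\times\dots\times S_{n_k}$ is identified with the permutations $\sigma\in S_n$ with $\sigma(D_j)=D_j$ for all $j$, and $A_{n_j}$ with the even permutations of $D_j$. *)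

(* Defs.v *)
From mathcomp Require Import all_boot all_fingroup.
Set Implicit Arguments. Unset Strict Implicit. Unset Printing Implicit Defensive.

Definition is_rack (X : finType) (op : X -> X -> X) : Prop :=
  (forall y, bijective (fun x => op x y)) /\
  (forall x y z, op (op z x) y = op (op z y) (op x y)).

Definition rinv (X : finType) (op : X -> X -> X) (y x : X) : X :=
  odflt x [pick z | op z y == x].

Definition rack_step (X : finType) (op : X -> X -> X) : rel X :=
  fun x z => [exists y, (op x y == z) || (op z y == x)].
Definition same_comp (X : finType) (op : X -> X -> X) : rel X :=
  connect (rack_step op).

Definition generates (X : finType) (op : X -> X -> X) (n : nat)
    (s : {ffun 'I_n -> X}) : Prop :=
  forall A : {set X}, (forall i, s i \in A) ->
    (forall x y, x \in A -> y \in A -> op x y \in A) -> A = setT.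

Definition Dset (X : finType) (op : X -> X -> X) (n : nat)
    (s : {ffun 'I_n -> X}) (c : X) : {set 'I_n} :=
  [set i | same_comp op (s i) c].

(* Braid words: letters (i, true) = sigma_i, (i, false) = sigma_i^{-1},
   positions 0-indexed, sigma_i swaps positions i and i+1; valid in B_n
   iff i+1 < n. *)
Definition braid_word (n : nat) (w : seq (nat * bool)) : bool :=
  all (fun g => g.1.+1 < n) w.

Definition pos (n k : nat) : option 'I_n := [pick j : 'I_n | val j == k].

Definition gen_act (X : finType) (op : X -> X -> X) (n : nat)
    (g : nat * bool) (f : {ffun 'I_n -> X}) : {ffun 'I_n -> X} :=
  let i := g.1 in
  match omap f (pos n i), omap f (pos n i.+1) with
  | Some a, Some b =>
      [ffun j : 'I_n =>
         if val j == i then (if g.2 then b else rinv op a b)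
         else if val j == i.+1 then (if g.2 then op a b else a)
         else f j]
  | _, _ => f
  end.

Definition braid_act (X : finType) (op : X -> X -> X) (n : nat)
    (w : seq (nat * bool)) (s : {ffun 'I_n -> X}) : {ffun 'I_n -> X} :=
  foldl (fun f g => gen_act op g f) s w.

Definition gen_perm (n : nat) (g : nat * bool) : 'S_n :=
  match pos n g.1, pos n g.1.+1 with
  | Some j, Some k => tperm j k
  | _, _ => 1%g
  end.

Definition braid_perm (n : nat) (w : seq (nat * bool)) : 'S_n :=
  (\prod_(g <- w) gen_perm n g)%g.

Definition in_alt_prod (X : finType) (op : X -> X -> X) (n : nat)
    (s : {ffun 'I_n -> X}) (sigma : 'S_n) : Prop :=
  forall c : X, sigma @: Dset op s c = Dset op s c /\
                ~~ odd_perm (restr_perm (Dset op s c) sigma).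

(* Main.v *)
Require Import Defs.
From mathcomp Require Import all_boot all_fingroup cyclic.
From Stdlib Require Import Setoid Morphisms.
Set Implicit Arguments. Unset Strict Implicit. Unset Printing Implicit Defensive.

(** Label the strands of [s] and consider lists of labelled elements of [X] up to
    braid moves; this is a congruence for concatenation.  If [m] is a common period
    of the maps [x |-> x^y], a block of [m] strands of the same colour [x] acts
    trivially, so it slides freely past everything; sliding it over a strand of
    colour [a] and back under it turns its colour into [x^a].  Hence, when the
    remaining strands generate [X], its colour can be changed to any [y] in the
    component of [x]; after absorbing a strand of colour [y], releasing another one
    and changing the colour back, a prescribed label has been brought into the block.

    Given three labels in one component containing many strands, the pigeonhole
    principle yields four such blocks avoiding these labels: three of them receive
    the labels, and the fourth keeps the colour [x] among the remaining strands.
    The list is thus equivalent to one where the three strands are adjacent and of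
    equal colour, on which an explicit 3-braid realises a 3-cycle.  Since
    equivalence commutes with relabelling, this 3-cycle is also realised at [s]. *)

(** * Labelled words up to braid moves *)

Section BraidEquivalence.

Variables (X : finType) (op : X -> X -> X) (I : eqType).
Implicit Types (T U V W : seq (I * X)) (ls : seq I) (i j k : I) (a b x y : X).

(** Labels travel with the strands, so the final list records the permutation of a braid together
    with its effect on the colours. *)
Inductive braid_equiv : seq (I * X) -> seq (I * X) -> Prop :=
| BraidRefl V : braid_equiv V V
| BraidCross U i a j b V :
    braid_equiv (U ++ (i, a) :: (j, b) :: V) (U ++ (j, b) :: (i, op a b) :: V)
| BraidSym U V : braid_equiv U V -> braid_equiv V U
| BraidTrans U V W : braid_equiv U V -> braid_equiv V W -> braid_equiv U W.

#[local] Hint Resolve BraidRefl : core.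

#[local] Instance braid_equiv_equivalence : Equivalence braid_equiv.
Proof. by split; [exact: BraidRefl | exact: BraidSym | exact: BraidTrans]. Qed.

#[local] Instance braid_equiv_cat :
  Proper (braid_equiv ==> braid_equiv ==> braid_equiv) (@cat (I * X)).
Proof.
have ctx U W V V' : braid_equiv V V' -> braid_equiv (U ++ V ++ W) (U ++ V' ++ W).
  elim=> {V V'} [V|U' i a j b V|V V' _|V1 V2 V3 _ h1 _]; [by []| |by symmetry|].
    by rewrite -!catA !catA -!(catA (U ++ U')); apply: BraidCross.
  exact: BraidTrans.
move=> V V' hV W W' hW; apply: (@BraidTrans _ (V' ++ W)).
  exact: (ctx [::]).
by have := ctx V' [::] _ _ hW; rewrite !cats0.
Qed.

Definition relabel (g : I -> I) V : seq (I * X) := [seq (g q.1, q.2) | q <- V].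

Lemma braid_equiv_relabel g U V :
  braid_equiv U V -> braid_equiv (relabel g U) (relabel g V).
Proof.
elim=> {U V} [V|U i a j b V|U V _ h|U V W _ h1 _ h2]; [by []| |by symmetry|].
  by rewrite /relabel !map_cat; apply: BraidCross.
exact: BraidTrans h2.
Qed.

(** A strand that has passed under all of [T] recovers its colour. *)
Definition central T := forall a, foldl op a (unzip2 T) = a.

Lemma strand_under i a T :
  braid_equiv ([:: (i, a)] ++ T) (T ++ [:: (i, foldl op a (unzip2 T))]).
Proof.
elim: T a => [|[j b] T IHT] a //=.
apply: (BraidTrans (BraidCross [::] i a j b T)).
exact: (braid_equiv_cat (BraidRefl [:: (j, b)]) (IHT _)).
Qed.

Lemma strand_over i a T :
  braid_equiv (T ++ [:: (i, a)]) ((i, a) :: [seq (q.1, op q.2 a) | q <- T]).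
Proof.
elim: T => [|[j b] T IHT] //=.
apply: BraidTrans (BraidCross [::] j b i a _).
exact: (braid_equiv_cat (BraidRefl [:: (j, b)]) IHT).
Qed.

Lemma central_comm U T : central T -> braid_equiv (U ++ T) (T ++ U).
Proof.
move=> cT; elim: U => [|[i a] U IHU]; first by rewrite cats0.
rewrite -cat1s -catA IHU !catA.
have := strand_under i a T; rewrite cT => ->.
by rewrite -catA.
Qed.

Definition monochrome ls x : seq (I * X) := [seq (i, x) | i <- ls].

Definition generating (xs : seq X) := forall A : {set X},
  {subset xs <= A} -> {in A &, forall x y, op x y \in A} -> A = setT.

(** Strands outside the selection pass under the selected ones; these keep the colour [x], while the
    colours in [U] may have changed. *)
Lemma gather_monochrome (P : pred I) x r V :
  r <= count (fun q => P q.1 && (q.2 == x)) V ->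
  exists ls U, [/\ size ls = r, all P ls & braid_equiv V (monochrome ls x ++ U)].
Proof.
case: r => [|r]; first by exists [::], V.
elim: V r => [|[i a] V IHV] r //=.
have [/andP[Pi /eqP->]|_] := boolP (P i && (a == x)); rewrite ?add0n ?add1n ?ltnS.
  case: r => [|r] h; first by exists [:: i], V; rewrite /= Pi.
  have [ls [U [sz al eqv]]] := IHV r h.
  exists (i :: ls), U; rewrite /= sz Pi; split=> //.
  by rewrite -cat1s eqv.
move=> /IHV [ls [U [sz al eqv]]].
exists ls; eexists; split=> //.
by rewrite -cat1s eqv catA (strand_under i a (monochrome ls x)) -catA; reflexivity.
Qed.

(** * Rack identities and a braid realising a 3-cycle *)

Hypothesis rackop : is_rack op.

Lemma op_bij y : bijective (op^~ y). Proof. by case: rackop. Qed.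
Lemma op_dist x y z : op (op z x) y = op (op z y) (op x y).
Proof. by case: rackop => _ ->. Qed.

(** This is self-distributivity with [y = x], applied to the preimage of [z] under [op^~ x]. *)
Lemma op_self z x : op z (op x x) = op z x.
Proof. by case: (op_bij x) => g _ gK; rewrite -(gK z) -op_dist. Qed.

(* With f := op^~ x, the elements f^a x form a rack in which every element acts
   by f; below, strand i is lowered from f^2 x to x by the pure braid
   A_jk A_ki^-1 A_ji^-1. *)
Lemma three_cycle_braid i j k x :
  braid_equiv (monochrome [:: i; j; k] x) (monochrome [:: j; k; i] x).
Proof.
set x1 := op x x; set x2 := op x1 x.
have op0 z : op z x1 = op z x by rewrite op_self.
have op1 z : op z x2 = op z x by rewrite /x2 -(op0 x1) op_self op0.
have cr u l l' a b c v : op a b = c ->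
  braid_equiv (u ++ (l, a) :: (l', b) :: v) (u ++ (l', b) :: (l, c) :: v).
  by move<-; apply: BraidCross.
transitivity [:: (j, x); (i, x1); (k, x)]; first exact: (cr [::]).
transitivity [:: (j, x); (k, x); (i, x2)]; first exact: (cr [:: _]).
transitivity [:: (k, x); (j, x1); (i, x2)]; first exact: (cr [::]).
transitivity [:: (j, x1); (k, x1); (i, x2)]; first by apply: (cr [::]); rewrite op0.
transitivity [:: (j, x1); (i, x1); (k, x1)].
  by symmetry; apply: (cr [:: _]); rewrite op0.
transitivity [:: (j, x1); (k, x); (i, x1)].
  by symmetry; apply: (cr [:: _]); rewrite op0.
transitivity [:: (k, x); (j, x2); (i, x1)]; first exact: (cr [::]).
transitivity [:: (k, x); (i, x); (j, x2)].
  by symmetry; apply: (cr [:: _]).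
transitivity [:: (k, x); (j, x1); (i, x)].
  by symmetry; apply: (cr [:: _]).
by symmetry; apply: (cr [::]).
Qed.

(** * Central blocks and the change of their colour *)

Definition rack_period := #|{perm X}|.

Lemma rack_period_gt0 : 0 < rack_period.
Proof. by apply/card_gt0P; exists 1%g. Qed.

(** By Lagrange, the order of every translation divides that of the symmetric group on [X]. *)
Lemma iter_rack_period y x : iter rack_period (op^~ y) x = x.
Proof.
pose p := perm (bij_inj (op_bij y)).
have /permP/(_ x) : (p ^+ rack_period = 1)%g.
  by rewrite /rack_period -cardsT; apply: expg_cardG; rewrite inE.
rewrite permX perm1 => {2}<-; apply: eq_iter => z.
by rewrite permE.
Qed.

Lemma central_monochrome ls x : size ls = rack_period -> central (monochrome ls x).
Proof.
move=> sz a; rewrite -[RHS](iter_rack_period x) -sz.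
by elim: ls a {sz} => [|i ls IHls] a //=; rewrite IHls -iterSr.
Qed.

Lemma monochrome_conj ls x i a V : size ls = rack_period -> (i, a) \in V ->
  braid_equiv (monochrome ls x ++ V) (monochrome ls (op x a) ++ V).
Proof.
move=> sz /path.splitPr [U W].
rewrite -[_ :: W]cat1s !catA -!(central_comm U (central_monochrome _ sz)) -!catA.
apply: braid_equiv_cat => //; rewrite !catA; apply: braid_equiv_cat => //.
(* The strand [(i, a)] crosses over the block and turns its colour into [op x a]; on the way back
   the block, being central, changes nothing. *)
rewrite strand_over -map_comp -[map _ _]/(monochrome ls (op x a)) -cat1s.
exact: central_comm (central_monochrome _ sz).
Qed.

Definition step_by (xs : seq X) : rel X :=
  fun x y => has (fun b => (op x b == y) || (op y b == x)) xs.

Lemma step_by_sym xs : connect_sym (step_by xs).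
Proof.
by apply: sym_connect_sym => x y; apply: eq_has => b; rewrite orbC.
Qed.

Lemma step_by_op xs b x : b \in xs -> connect (step_by xs) x (op x b).
Proof. by move=> bxs; apply: connect1; apply/hasP; exists b; rewrite // eqxx. Qed.

(** The elements [a] that always keep [z] and [op z a] connected contain [xs] and are closed under
    [op]: if [z = op w b], then [op z (op a b) = op (op w a) b]. Hence they are all of [X]. *)
Lemma generating_connect xs x y :
  generating xs -> same_comp op x y -> connect (step_by xs) x y.
Proof.
move=> gen; have /setP allA :
    [set a | [forall z, connect (step_by xs) z (op z a)]] = setT.
  apply: gen => [a axs|a b]; rewrite !inE.
    by apply/forallP => z; apply: step_by_op.
  move=> /forallP ha /forallP hb; apply/forallP => z.
  case: (op_bij b) => g _ gK; rewrite -(gK z) -op_dist.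
  apply: connect_trans (connect_trans (ha (g z)) (hb _)).
  by rewrite step_by_sym.
have conn z a : connect (step_by xs) z (op z a).
  by have := allA a; rewrite !inE => /forallP.
apply: connect_sub => {}x {}y /existsP[a /orP[]/eqP<- //].
by rewrite step_by_sym.
Qed.

Lemma monochrome_recolor ls x y V : size ls = rack_period ->
  generating (unzip2 V) -> same_comp op x y ->
  braid_equiv (monochrome ls x ++ V) (monochrome ls y ++ V).
Proof.
move=> sz gen /(generating_connect gen)/connectP[p + ->] {y}.
elim: p x => [|y p IHp] x //= /andP[/hasP[b /mapP[[i c] ibV /= ->] e] /IHp <-].
by case/orP: e => /eqP <-; [|symmetry]; apply: monochrome_conj ibV.
Qed.

Lemma exchange_label i y V1 V2 j ls x : (size ls).+1 = rack_period ->
  generating (unzip2 (V1 ++ (i, y) :: V2)) -> same_comp op x y ->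
  braid_equiv (monochrome (j :: ls) x ++ V1 ++ (i, y) :: V2)
              (monochrome (rcons ls i) x ++ V1 ++ (j, y) :: V2).
Proof.
move=> sz gen cxy.
have gen' : generating (unzip2 (V1 ++ (j, y) :: V2)).
  by move: gen; rewrite /unzip2 !map_cat.
have sz' : size (rcons ls i) = rack_period by rewrite size_rcons.
rewrite (monochrome_recolor _ gen cxy) // (monochrome_recolor sz' gen' cxy).
rewrite !catA -!(central_comm V1) -?catA; try exact: central_monochrome.
apply: braid_equiv_cat => //.
rewrite -[_ :: V2]cat1s -[(j, y) :: V2]cat1s !catA; apply: braid_equiv_cat => //.
(* The block [j :: ls] followed by [i] and the strand [j] followed by the block [rcons ls i] are the
   same list of strands of colour [y]. *)
rewrite -(central_comm _ (central_monochrome y sz')).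
by rewrite /monochrome map_rcons -cats1.
Qed.

(** * Invariants of braid equivalence *)

Definition comp_of := root (rack_step op).

Lemma rack_step_sym : connect_sym (rack_step op).
Proof.
by apply: sym_connect_sym => x y; apply: eq_existsb => b; rewrite orbC.
Qed.

Lemma comp_ofE x y : (comp_of x == comp_of y) = same_comp op x y.
Proof. exact/(root_connect rack_step_sym). Qed.

(** A crossing changes a colour only within its component, so these pairs follow the strands. *)
Definition label_comps V := [seq (q.1, comp_of q.2) | q <- V].

Lemma braid_equiv_label_comps U V :
  braid_equiv U V -> perm_eq (label_comps U) (label_comps V).
Proof.
elim=> {U V} [V|U i a j b V|U V _|U V W _ h1 _ h2] //; last exact: perm_trans h2.
  rewrite /label_comps !map_cat perm_cat2l /=.
  have -> : comp_of (op a b) = comp_of a.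
    apply/eqP; rewrite comp_ofE; apply: connect1; apply/existsP; exists b.
    by rewrite eqxx orbT.
  exact: (permEl (perm_catCA [:: _] [:: _] _)).
by rewrite perm_sym.
Qed.

(** A set closed under [op] is closed under the inverse action of its elements, a power of the
    action by periodicity. So it contains the colours before a crossing iff it contains those after
    it. *)
Lemma braid_equiv_generating U V :
  braid_equiv U V -> generating (unzip2 U) -> generating (unzip2 V).
Proof.
move=> eqv gen A sub clA; apply: gen (clA); move: sub.
suff: {subset unzip2 U <= A} <-> {subset unzip2 V <= A} by case.
have clV a b : b \in A -> (op a b \in A) = (a \in A).
  move=> bA; apply/idP/idP => [abA|/clA->//].
  rewrite -(iter_rack_period b a) -(prednK rack_period_gt0) iterSr.
  by elim: rack_period.-1 => //= r IH; apply: clA.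
elim: eqv => {U V} [V|U i a j b V|U V _|U V W _ h1 _ h2] //.
- rewrite /unzip2 !map_cat /=.
  have e (xs : seq X) : {subset xs <= A} <-> all (mem A) xs by split=> /allP.
  rewrite !e !all_cat /=; case bA: (b \in A); rewrite ?andbF ?clV //.
- by case.
- by rewrite h1.
Qed.

(** * Bringing three labels together in one colour *)

Lemma pigeonhole_color (P : pred (I * X)) r V : #|X| * r < count P V ->
  exists x, r <= count (fun q => P q && (q.2 == x)) V.
Proof.
have -> : count P V = \sum_x count (fun q => P q && (q.2 == x)) V.
  elim: V => [|q V IHV] /=; first by rewrite big1.
  rewrite big_split /= -IHV; congr (_ + _).
  rewrite (bigD1 q.2) //= eqxx andbT big1 ?addn0 // => x /negPf.
  by rewrite eq_sym => ->; rewrite andbF.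
move=> lt; apply/existsP; apply: contraTT lt => /existsPn lt.
rewrite -leqNgt -sum_nat_const; apply: leq_sum => x _.
by rewrite leqNgt (contra _ (lt x)) // => /ltnW.
Qed.

(** The block trades its first label for [i]; the colours of [V] stay the same. The last clause
    allows the exchange to be repeated for other labels. *)
Lemma bring_label ls x V i : size ls = rack_period ->
  generating (unzip2 V) -> (i, comp_of x) \in label_comps V ->
  exists ls' V', [/\ braid_equiv (monochrome ls x ++ V) (monochrome (rcons ls' i) x ++ V'),
    size (rcons ls' i) = rack_period, generating (unzip2 V') &
    forall k c, k != i -> (k, c) \in label_comps V -> (k, c) \in label_comps V'].
Proof.
case: ls => [|j ls] sz; first by have := rack_period_gt0; rewrite -sz.
move=> gen /mapP[[i' y] iV /= [? /eqP]]; subst i'; rewrite comp_ofE => cxy.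
case/path.splitPr: iV gen => V1 V2 gen.
exists ls, (V1 ++ (j, y) :: V2); split; first exact: exchange_label.
- by rewrite size_rcons.
- by move: gen; rewrite /unzip2 !map_cat.
move=> k c /negPf ki; rewrite /label_comps !map_cat !mem_cat !inE /=.
by rewrite {1}/eq_op /= ki /= => /orP[]->; rewrite ?orbT.
Qed.

Lemma monochrome_cat ls ls' x :
  monochrome (ls ++ ls') x = monochrome ls x ++ monochrome ls' x.
Proof. exact: map_cat. Qed.

Lemma monochrome_rcons ls i x :
  monochrome (rcons ls i) x = monochrome ls x ++ [:: (i, x)].
Proof. by rewrite -cats1 monochrome_cat. Qed.

Lemma gather_triple V i1 i2 i3 c : generating (unzip2 V) -> uniq [:: i1; i2; i3] ->
  {in [:: i1; i2; i3], forall i, (i, c) \in label_comps V} ->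
  #|X| * (4 * rack_period) <
    count (fun q => (q.1 \notin [:: i1; i2; i3]) && (comp_of q.2 == c)) V ->
  exists x ls U, braid_equiv V (monochrome ls x ++ monochrome [:: i3; i2; i1] x ++ U).
Proof.
move=> gen + inV /pigeonhole_color[x].
rewrite /= !inE negb_or !andbT => /andP[/andP[i12 i13] i23] cnt.
have xc : comp_of x = c.
  have: 0 < count (fun q => (q.1 \notin [:: i1; i2; i3]) && (comp_of q.2 == c) && (q.2 == x)) V.
    by apply: leq_trans cnt; rewrite muln_gt0 rack_period_gt0.
  by rewrite -has_count => /hasP[q _ /andP[/andP[_ /eqP<-] /eqP->]].
have [ls [U [szls lsP eqV]]] :
  exists ls U, [/\ size ls = 4 * rack_period, all (fun i => i \notin [:: i1; i2; i3]) ls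
    & braid_equiv V (monochrome ls x ++ U)].
  apply: gather_monochrome; apply: leq_trans cnt _; apply: sub_count => q.
  by move=> /andP[/andP[-> _] ->].
have split r (l : seq I) : size l = rack_period + r ->
    exists l' l'', [/\ l = l' ++ l'', size l' = rack_period & size l'' = r].
  move=> sz; exists (take rack_period l), (drop rack_period l).
  by rewrite cat_take_drop size_drop size_takel sz ?leq_addr ?addKn.
move: szls; rewrite !mulSn mul0n addn0.
move=> /split[l3 [l2' [els sz3 /split[l2 [l1' [el2' sz2 /split[l1 [l4 [el1' sz1 sz4]]]]]]]]].
have {}eqV : braid_equiv V
    (monochrome l3 x ++ monochrome l2 x ++ monochrome l1 x ++ monochrome l4 x ++ U).
  by rewrite eqV els el2' el1' !monochrome_cat -!catA.
(* The blocks [l1], [l2], [l3] supply only the colour [x], which the nonempty block [l4] retains. *)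
have genU : generating (unzip2 (monochrome l4 x ++ U)).
  have := braid_equiv_generating eqV gen.
  move=> gen' A sub; apply: gen' => a; apply: contraTT => aA.
  apply: contraNN (aA); rewrite /unzip2 !map_cat !mem_cat => h.
  apply: sub; rewrite /unzip2 !map_cat !mem_cat.
  have xl4 : x \in unzip2 (monochrome l4 x).
    case: {+}l4 sz4 => [sz4|i l _]; last by rewrite inE eqxx.
    by have := rack_period_gt0; rewrite -sz4.
  have cst l : (a \in unzip2 (monochrome l x)) -> a \in unzip2 (monochrome l4 x).
    by move=> /mapP[[k y] /mapP[i _ [_ ->]] ->].
  by move: h; case/or4P=> [/cst->|/cst->|/cst->|->].
have inU : {in [:: i1; i2; i3], forall i, (i, comp_of x) \in label_comps (monochrome l4 x ++ U)}.
  move=> i ii; have := inV i ii; rewrite (perm_mem (braid_equiv_label_comps eqV)) xc.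
  rewrite /label_comps !map_cat !mem_cat.
  have nl l : {subset l <= ls} -> (i, c) \in label_comps (monochrome l x) = false.
    move=> sub; apply/negP => /mapP[[k y] /mapP[i' /sub il [-> _]] [e _]].
    by have := allP lsP _ il; rewrite -e /= ii.
  rewrite !nl // => k kl; rewrite els ?el2' ?el1' !mem_cat kl ?orbT //.
have [|k1 [U1 [eq1 szk1 gen1 in1]]] := bring_label (x := x) sz1 genU (i := i1).
  by apply: inU; rewrite inE eqxx.
have [|k2 [U2 [eq2 szk2 gen2 in2]]] := bring_label (x := x) sz2 gen1 (i := i2).
  by apply: in1; [rewrite eq_sym | apply: inU; rewrite !inE eqxx orbT].
have [|k3 [U3 [eq3 szk3 gen3 in3]]] := bring_label (x := x) sz3 gen2 (i := i3).
  apply: in2; first by rewrite eq_sym.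
  by apply: in1; [rewrite eq_sym | apply: inU; rewrite !inE eqxx !orbT].
exists x, (k1 ++ k2 ++ k3), U3.
have cent l W Z : size l = rack_period ->
    braid_equiv (W ++ monochrome l x ++ Z) (monochrome l x ++ W ++ Z).
  by move=> sz; rewrite !catA (central_comm W (central_monochrome x sz)).
(* Full blocks slide past everything, so their last strands can be split off and collected on the
   right, in the order [i3], [i2], [i1]. *)
rewrite eqV eq1 -(cent l2) // eq2 -(cent l3) // -(cent l3) // eq3.
rewrite monochrome_rcons -!catA cent // (cent (rcons k3 i3)) //.
rewrite (monochrome_rcons k2) -!catA (cent (rcons k3 i3)) //.
by rewrite monochrome_rcons !monochrome_cat -!catA.
Qed.

(** Labels being unique, [tau] fixes those outside the triple, so on the gathered list it is a
    rotation of three adjacent strands. Relabelling the gathering equivalence carries this back to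
    [V]. *)
Lemma three_cycle_relabel V i1 i2 i3 c (tau : I -> I) :
  uniq (unzip1 V) -> generating (unzip2 V) -> uniq [:: i1; i2; i3] ->
  {in [:: i1; i2; i3], forall i, (i, c) \in label_comps V} ->
  #|X| * (4 * rack_period) <
    count (fun q => (q.1 \notin [:: i1; i2; i3]) && (comp_of q.2 == c)) V ->
  tau i3 = i2 -> tau i2 = i1 -> tau i1 = i3 ->
  (forall i, i \notin [:: i1; i2; i3] -> tau i = i) ->
  braid_equiv V (relabel tau V).
Proof.
move=> uV gen ui inV cnt t3 t2 t1 tfix.
have [x [ls [U eqv]]] := gather_triple gen ui inV cnt.
transitivity (relabel tau (monochrome ls x ++ monochrome [:: i3; i2; i1] x ++ U)); last first.
  by symmetry; apply: braid_equiv_relabel.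
have {}uV : uniq (unzip1 (monochrome ls x ++ monochrome [:: i3; i2; i1] x ++ U)).
  have := perm_map fst (braid_equiv_label_comps eqv).
  by rewrite /label_comps -!map_comp => /perm_uniq <-.
have fixW W : {in unzip1 W, forall i, i \notin [:: i1; i2; i3]} -> relabel tau W = W.
  move=> h; rewrite /relabel -[RHS]map_id; apply/eq_in_map => -[i a] iW /=.
  by rewrite tfix // h //; apply/mapP; exists (i, a).
move: uV; rewrite /unzip1 !map_cat !cat_uniq => /and3P[_ /hasPn dls /and3P[_ /hasPn dU _]].
rewrite /relabel !map_cat -!/(relabel _ _) (fixW (monochrome ls x)) ?(fixW U).
- rewrite eqv /= t1 t2 t3; apply: braid_equiv_cat => //.
  by apply: (braid_equiv_cat (three_cycle_braid i3 i2 i1 x)).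
- move=> i /dU; apply: contraNN; rewrite !inE.
  by case/or3P=> ->; rewrite ?orbT.
- move=> i; apply: contraTN => it; apply: dls; rewrite mem_cat; apply/orP; left.
  by move: it; rewrite !inE; case/or3P=> ->; rewrite ?orbT.
Qed.

End BraidEquivalence.

(** * From equivalences to braid words *)

Section BraidWords.

Variables (X : finType) (op : X -> X -> X) (n : nat).
Implicit Types (p : 'S_n) (f : {ffun 'I_n -> X}).

Definition strands p f : seq ('I_n * X) := [seq (p i, f i) | i <- enum 'I_n].

Lemma map_eq_cat2 (A B : Type) (h : A -> B) e U q0 q1 V :
  map h e = U ++ q0 :: q1 :: V ->
  exists e1 k0 k1 e2, [/\ e = e1 ++ k0 :: k1 :: e2, map h e1 = U, h k0 = q0,
    h k1 = q1 & map h e2 = V].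
Proof.
elim: U e => [|u U IHU] [|k e] //=.
  by case: e => [|k1 e] //= [<- <- <-]; exists [::], k, k1, e.
case=> <- /IHU[e1 [k0 [k1 [e2 [-> <- <- <- <-]]]]].
by exists (k :: e1), k0, k1, e2.
Qed.

(** Locates a crossing inside the tuple; the last clause rebuilds the list after a change at these
    two positions only. *)
Lemma strands_cat2 p f U q0 q1 V : strands p f = U ++ q0 :: q1 :: V ->
  exists k0 k1 : 'I_n, [/\ val k0 = size U, val k1 = (size U).+1, (p k0, f k0) = q0,
    (p k1, f k1) = q1 &
    forall p' f', (forall k, k != k0 -> k != k1 -> p' k = p k /\ f' k = f k) ->
      strands p' f' = U ++ (p' k0, f' k0) :: (p' k1, f' k1) :: V].
Proof.
move=> eqs; have [e1 [k0 [k1 [e2 [ee <- e0 e1' <-]]]]] := map_eq_cat2 eqs.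
have sz : size e1 + (size e2).+2 = n by rewrite -[RHS]size_enum_ord ee size_cat.
have k0E : val k0 = size e1.
  have lt : size e1 < n by rewrite -[X in _ < X]sz -addSnnS leq_addr.
  by have := nth_enum_ord k0 lt; rewrite ee nth_cat ltnn subnn.
have k1E : val k1 = (size e1).+1.
  have lt : (size e1).+1 < n by rewrite -[X in _ < X]sz -2!addSnnS leq_addr.
  by have := nth_enum_ord k0 lt; rewrite ee nth_cat ltnNge leqnSn /= subSnn.
exists k0, k1; rewrite size_map; split=> // p' f' eqf.
have := enum_uniq 'I_n; rewrite ee cat_uniq /= !inE !negb_or.
case/and3P=> _ /and3P[k0e1 k1e1 /hasPn e21] /and3P[/andP[_ k0e2] k1e2 _].
have eqm (e : seq 'I_n) : k0 \notin e -> k1 \notin e ->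
    [seq (p' i, f' i) | i <- e] = [seq (p i, f i) | i <- e].
  move=> h0 h1; apply/eq_in_map => k ke.
  by have [||-> ->] := eqf k; [apply: contraNneq h0 => <-|apply: contraNneq h1 => <-|].
by rewrite /strands ee map_cat /= !eqm.
Qed.

Lemma posE (k : 'I_n) : pos n k = Some k.
Proof.
by rewrite /pos; case: pickP => [j /eqP/val_inj->|/(_ k)] //; rewrite eqxx.
Qed.

(** The strand at position [k] after [w] started at position [(braid_perm n w)^-1 k], whence the
    inverse. *)
Definition reachable p f V := exists w, braid_word n w /\
  V = strands ((braid_perm n w)^-1 * p)%g (braid_act op w f).

Lemma reachable_trans p f V W : reachable p f V ->
  (forall p f, V = strands p f -> reachable p f W) -> reachable p f W.
Proof.
move=> [w [wn ->]] /(_ _ _ erefl)[w' [w'n ->]].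
exists (w ++ w'); split; first by rewrite /braid_word all_cat; apply/andP.
by rewrite /braid_act foldl_cat /braid_perm big_cat /= invMg mulgA.
Qed.

Lemma reachable_gen p f (k0 k1 : 'I_n) b p' f' : val k1 = (val k0).+1 ->
  p' = (tperm k0 k1 * p)%g -> gen_act op (val k0, b) f = f' ->
  reachable p f (strands p' f').
Proof.
move=> k1E -> <-; exists [:: (val k0, b)]; split.
  by rewrite /braid_word /= andbT -k1E; apply: ltn_ord.
by rewrite /braid_perm big_seq1 /gen_perm /= -k1E !posE tpermV.
Qed.

(** Both directions are proved at once, so symmetry is a swap: a crossing read forwards is a
    positive letter, read backwards a negative one. *)
Lemma braid_equiv_reachable U V : is_rack op -> braid_equiv op U V ->
  (forall p f, U = strands p f -> reachable p f V) /\
  (forall p f, V = strands p f -> reachable p f U).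
Proof.
move=> rackop; elim=> {U V} [V|U i a j b V|U V _ [h1 h2] //|U V W _ [h1 h1'] _ [h2 h2']].
- have r p f : V = strands p f -> reachable p f V.
    by move=> ->; exists [::]; rewrite /braid_perm big_nil invg1 mul1g.
  by split.
- have neq (k0 k1 : 'I_n) : val k1 = (val k0).+1 -> (k1 == k0) = false.
    by move=> k01; rewrite -val_eqE k01 gtn_eqF.
  split=> p f /esym/strands_cat2[k0 [k1 [k0E k1E [e0p e0f] [e1p e1f] eqs]]].
  + have k01 : val k1 = (val k0).+1 by rewrite k0E.
    have k10 := neq _ _ k01.
    pose f' := [ffun k => if k == k0 then b else if k == k1 then op a b else f k].
    pose p' := (tperm k0 k1 * p)%g.
    have -> : U ++ (j, b) :: (i, op a b) :: V = strands p' f'.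
      rewrite (eqs p' f') => [|k kk0 kk1]; last first.
        by rewrite /p' !ffunE (negPf kk0) (negPf kk1) permM tpermD // eq_sym.
      by rewrite /p' !ffunE !permM tpermL tpermR e0p e1p k10 !eqxx.
    apply: (reachable_gen (b := true) k01) => //.
    rewrite /gen_act /= -k01 !posE /=; apply/ffunP => k.
    by rewrite !ffunE e0f e1f.
  + have k01 : val k1 = (val k0).+1 by rewrite k0E.
    have k10 := neq _ _ k01.
    pose f' := [ffun k => if k == k0 then a else if k == k1 then b else f k].
    pose p' := (tperm k0 k1 * p)%g.
    have -> : U ++ (i, a) :: (j, b) :: V = strands p' f'.
      rewrite (eqs p' f') => [|k kk0 kk1]; last first.
        by rewrite /p' !ffunE (negPf kk0) (negPf kk1) permM tpermD // eq_sym.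
      by rewrite /p' !ffunE !permM tpermL tpermR e0p e1p k10 !eqxx.
    apply: (reachable_gen (b := false) k01) => //.
    (* The default value of [rinv] is never taken, since [a] is a preimage; by injectivity it is the
       only one. *)
    have rinvK : rinv op b (op a b) = a.
      rewrite /rinv; case: pickP => [z /eqP|/(_ a)]; last by rewrite eqxx.
      by apply: (bij_inj (op_bij rackop b)).
    rewrite /gen_act /= -k01 !posE /=; apply/ffunP => k.
    by rewrite !ffunE e0f e1f rinvK.
- by split=> p f e; [apply: reachable_trans (h1 p f e) h2|apply: reachable_trans (h2' p f e) h1'].
Qed.

End BraidWords.

(** * Permutations even on every block *)

Section EvenBlocks.

Variables (T : finType) (K : Type) (D : K -> {set T}).

Lemma restr_tperm (A : {set T}) a b : (a \in A) = (b \in A) ->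
  tperm a b \in 'N(A | 'P)%g /\
  restr_perm A (tperm a b) = if a \in A then tperm a b else 1%g.
Proof.
move=> ab; have nA : tperm a b \in 'N(A | 'P)%g.
  by apply/astabsP => x; rewrite /= apermE; case: tpermP => [->|->|].
split=> //; apply/permP => x; case: (boolP (x \in A)) => xA.
  rewrite restr_permE //; case: ifP => // aA; rewrite perm1 tpermD //.
    by apply: contraTneq xA => <-; rewrite aA.
  by apply: contraTneq xA => <-; rewrite -ab aA.
rewrite (out_perm (restr_perm_on _ _)) //; case: ifP => aA; rewrite ?perm1 // tpermD //.
  by apply: contraNneq xA => <-.
by apply: contraNneq xA => <-; rewrite -ab.
Qed.

Lemma imset_astabs (A : {set T}) (u : {perm T}) : u @: A = A <-> u \in 'N(A | 'P)%g.
Proof.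
split=> [uA|/astabsP uA].
  by apply/astabsP => x /=; rewrite apermE -{1}uA mem_imset //; apply: perm_inj.
apply/setP => x; rewrite -[x](permKV u) mem_imset; last exact: perm_inj.
by rewrite -uA.
Qed.

(* A permutation even on each block is not a transposition on any of them, so a
   3-cycle inside its support can be used to make it fix one more point. *)
Lemma even_blocks_ind (H : {perm T} -> Prop) :
  (forall i, exists c, i \in D c) ->
  (forall c c' i, i \in D c -> i \in D c' -> D c = D c') ->
  H 1%g -> (forall u v, H u -> H v -> H (u * v)%g) ->
  (forall c i j k, i \in D c -> j \in D c -> k \in D c -> uniq [:: i; j; k] ->
     H (tperm i j * tperm i k)%g) ->
  forall u : {perm T},
    (forall c, u @: D c = D c /\ ~~ odd_perm (restr_perm (D c) u)) -> H u.
Proof.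
move=> covD eqD H1 HM H3 u.
have [r] := ubnP #|[set i | u i != i]|; elim: r u => // r IHr u ltr uD.
case: (pickP (fun i => u i != i)) => [i ui|u1]; last first.
  suff -> : u = 1%g by [].
  by apply/permP => i; rewrite perm1; apply/eqP; rewrite -[_ == _]negbK u1.
have [c ic] := covD i; have [uDc evc] := uD c.
have uN : u \in 'N(D c | 'P)%g by apply/imset_astabs.
have uin x : (u x \in D c) = (x \in D c) by rewrite -{1}uDc mem_imset //; apply: perm_inj.
pose j := u i; have jc : j \in D c by rewrite uin.
have uj : u j != j by rewrite /j (inj_eq perm_inj).
have [k /and4P[kc ki kj uk]|nok] :=
    pickP (fun k => [&& k \in D c, k != i, k != j & u k != k]); last first.
  case/negP: evc; suff -> : restr_perm (D c) u = tperm i j by rewrite odd_tperm eq_sym.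
  have uji : u j = i.
    have := nok (u j); rewrite uin jc (inj_eq perm_inj) uj !andbT /=.
    by move/negbT; rewrite negbK => /eqP.
  apply/permP => x; case: (boolP (x \in D c)) => xc; last first.
    rewrite (out_perm (restr_perm_on _ _)) // tpermD //.
      by apply: contraNneq xc => <-.
    by apply: contraNneq xc => <-.
  rewrite restr_permE //; case: tpermP => [->|->|/eqP xi /eqP xj] //.
  by have := nok x; rewrite xc xi xj /= => /negbT; rewrite negbK => /eqP.
(* Products act left to right, so [u * t] sends [i] to [j] and back to [i]; points fixed by [u]
   differ from [i], [j], [k] and stay fixed. *)
pose t := (tperm j i * tperm j k)%g.
have tV : (tperm j k * tperm j i = t^-1)%g by rewrite invMg !tpermV.
have -> : u = ((u * t) * t^-1)%g by rewrite mulgK.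
have ij : i != j by rewrite eq_sym.
apply: HM; last first.
  by rewrite -tV; apply: (H3 c) => //=; rewrite !inE negb_or eq_sym kj eq_sym ij ki.
apply: IHr => [|c'].
  rewrite -ltnS; apply: leq_trans ltr; rewrite ltnS; apply: proper_card; apply/properP; split.
    apply/subsetP => x; rewrite !inE; apply: contraNN => /eqP ux.
    rewrite permM ux /t permM.
    have nx y : u y != y -> y != x by apply: contraNneq => ->; rewrite ux.
    by rewrite !tpermD ?nx.
  by exists i; rewrite !inE // permM -/j permM tpermL tpermD ?eqxx // eq_sym.
have [uDc' evc'] := uD c'.
(* Blocks that meet coincide, so [t] acts on each block as a 3-cycle or trivially. *)
have jk : (j \in D c') = (k \in D c').
  by apply/idP/idP => [/(eqD _ _ _ jc) <-|/(eqD _ _ _ kc) <-].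
have ji : (j \in D c') = (i \in D c').
  by apply/idP/idP => [/(eqD _ _ _ jc) <-|/(eqD _ _ _ ic) <-].
have [n1 e1] := restr_tperm ji; have [n2 e2] := restr_tperm jk.
have uN' : u \in 'N(D c' | 'P)%g by apply/imset_astabs.
split; first by apply/imset_astabs; rewrite !groupM.
rewrite !morphM ?groupM //= e1 e2 !odd_permM (negPf evc') addFb.
by case: ifP => _; rewrite ?odd_tperm ?odd_perm1 // (eq_sym j i) (eq_sym j k) kj ij.
Qed.

End EvenBlocks.

(** * Realising permutations that are even on each component *)

Theorem theorem4p32 (X : finType) (op : X -> X -> X) :
  is_rack op ->
  exists N : nat, forall (n : nat) (s : {ffun 'I_n -> X}),
    generates op s ->
    (forall c : X, N <= #|Dset op s c|) ->
    forall sigma : 'S_n, in_alt_prod op s sigma ->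
      exists w : seq (nat * bool),
        [/\ braid_word n w, braid_act op w s = s & braid_perm n w = sigma].
Proof.
(* Of the additional 4 strands, three are those of the 3-cycle and one makes the pigeonhole
   inequality strict. *)
move=> rackop; exists (#|X| * (4 * rack_period X) + 4) => n s gens big sigma alt.
pose L := strands 1%g s.
have uL : uniq (unzip1 L).
  rewrite /unzip1 -map_comp (eq_map (g := id)) ?map_id ?enum_uniq // => i.
  by rewrite /= perm1.
have genL : generating op (unzip2 L).
  move=> A sub clA; apply: gens => [i|]; last exact: clA.
  by apply: sub; rewrite /unzip2 -map_comp; apply/mapP; exists i; rewrite ?mem_enum.
have Hsigma : braid_equiv op L (relabel sigma L).
  have inD c i : (i \in Dset op s c) = same_comp op (s i) c by rewrite inE.
  move: alt; apply: (even_blocks_ind (H := fun u => braid_equiv op L (relabel u L))).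
  - by move=> i; exists (s i); rewrite inD; apply: connect0.
  - move=> c c' i; rewrite !inD -!comp_ofE => /eqP e /eqP e'.
    by apply/setP => k; rewrite !inD -!comp_ofE -e -e'.
  - suff -> : relabel (1%g : 'S_n) L = L by apply: BraidRefl.
    by rewrite /relabel -[RHS]map_id; apply: eq_map => -[i a]; rewrite /= perm1.
  - move=> u v hu hv; apply: (BraidTrans hv).
    suff -> : relabel (u * v : 'S_n)%g L = relabel v (relabel u L) by apply: braid_equiv_relabel.
    by rewrite /relabel -map_comp; apply: eq_map => q; rewrite /= permM.
  - move=> c i j k ic jc kc /[dup] uijk; rewrite /= !inE negb_or !andbT.
    case/andP=> /andP[ij ik] jk.
    (* The product maps [i] to [j], [j] to [k] and [k] to [i], hence the reversed order of the
       triple. *)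
    apply: (three_cycle_relabel rackop (i1 := k) (i2 := j) (i3 := i) (c := comp_of op c)).
    + exact: uL.
    + exact: genL.
    + by rewrite -rev_uniq.
    + move=> l lijk; have : l \in Dset op s c.
        by move: lijk; rewrite !inE => /or3P[]/eqP->; rewrite -inD.
      rewrite inD -comp_ofE => /eqP <-.
      by rewrite /label_comps -map_comp; apply/mapP; exists l; rewrite ?mem_enum //= perm1.
    + rewrite count_map.
      rewrite (eq_count (a2 := mem (Dset op s c :\: [set k; j; i]))) => [|l]; last first.
        by rewrite /= perm1 !inE comp_ofE -orbA.
      rewrite -size_filter enumT -[filter _ _]/(enum _) -cardE.
      have le3 : #|Dset op s c :&: [set k; j; i]| <= 3.
        apply: leq_trans (subset_leq_card (subsetIr _ _)) _.
        by rewrite setUC cardsU1 cards2; case: (_ \notin _); case: (_ != _).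
      have := big c; rewrite -(cardsID [set k; j; i]) => bigc.
      rewrite -(leq_add2l 3) addnC addSnnS; apply: leq_trans bigc _.
      by rewrite leq_add2r.
    + by rewrite permM tpermL tpermD // eq_sym.
    + by rewrite permM tpermR tpermL.
    + by rewrite permM (tpermD (z := k)) ?tpermR // eq_sym.
    + move=> l; rewrite !inE !negb_or => /and3P[lk lj li].
      by rewrite permM !tpermD // eq_sym.
(* A word with permutation [sigma] that fixes [s] leaves the label [sigma^-1 i] at position [i], so
   the relabelling to be realised is the one by the inverse. *)
have {}Hsigma : braid_equiv op L (relabel (sigma^-1 : 'S_n)%g L).
  have := braid_equiv_relabel (sigma^-1 : 'S_n)%g Hsigma.
  suff -> : relabel (sigma^-1 : 'S_n)%g (relabel sigma L) = L by apply: BraidSym.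
  rewrite /relabel -map_comp -[RHS]map_id; apply: eq_map => -[i a] /=.
  by rewrite permK.
have [/(_ 1%g s erefl)[w [wn +]] _] := braid_equiv_reachable rackop Hsigma.
rewrite /relabel /L /strands -map_comp => /eq_in_map eqw.
have {}eqw i : (sigma^-1)%g i = ((braid_perm n w)^-1)%g i /\ s i = braid_act op w s i.
  by have [] := eqw i (mem_enum _ _); rewrite !(perm1, mulg1).
exists w; split=> //; first by apply/ffunP => i; rewrite -(eqw i).2.
by apply: invg_inj; apply/permP => i; rewrite -(eqw i).1.
Qed.
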